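(* Let $N$ be a nonempty set, $\mathcal{B}\subseteq 2^N$ a Boolean algebra of subsets of $N$, $X$ a set with $\#X\ge2$, $\mathcal{W}\subseteq\mathcal{B}$ a simple game and $B\subseteq X$ an agenda. For each profile $\mathbf{p}$, we have $$C^+(\mathcal{W},B,\mathbf{p})\subseteq C(\mathcal{W},B,\mathbf{p})\cap\Bigl(\bigcup_{i\in N}\max\nolimits_B\succ_i^{\mathbf{p}}\Bigr).$$
   Context: A ($\mathcal{B}$-)simple game is a collection $\mathcal{W}\subseteq\mathcal{B}$ with $\emptyset\notin\mathcal{W}$ and $\mathcal{W}\ne\emptyset$. A preference is an asymmetric binary relation on $X$. A profile is a family $\mathbf{p}=(\succ_i^{\mathbf{p}})_{i\in N}$ of preferences (no measurability or existence of maximal elements is required here). An agenda is a subset $B\subseteq X$. $\max_B\succ$ is the set of $x\in B$ such that there is no $y\in B$ with $y\succ x$. Core: $C(\mathcal{W},B,\mathbf{p})$ is the set of $x\in B$ such that there are no $y\in B$ and $S\in\mathcal{W}$ with $y\succ_i^{\mathbf{p}}x$ for all $i\in S$. Core without majority dissatisfaction: $C^+(\mathcal{W},B,\mathbf{p})$ is the set of $x\in B$ such that there is no $S\in\mathcal{W}$ such that for all $i\in S$ there exists some $y_i\in B$ with $y_i\succ_i^{\mathbf{p}}x$. *)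

(* Defs.v *)
From mathcomp Require Import all_boot.
From mathcomp Require Import boolp classical_sets functions cardinality.
From mathcomp Require Import measurable_structure.
From Corelib Require Import RelationClasses.

Set Implicit Arguments.
Unset Strict Implicit.
Unset Printing Implicit Defensive.

Local Open Scope classical_set_scope.

Definition algebra_of_sets (N : Type) (BB : set (set N)) : Prop :=
  [/\ BB set0, setU_closed BB & setC_closed BB].

Definition simple_game (N : Type) (BB W : set (set N)) : Prop :=
  [/\ W `<=` BB, ~ W set0 & W !=set0].

(* [p i y x] reads: individual [i] prefers [y] to [x]. *)
Definition profile (N X : Type) (p : N -> X -> X -> Prop) : Prop :=
  forall i, Asymmetric (p i).

Definition max_on (X : Type) (B : set X) (R : X -> X -> Prop) : set X :=
  [set x | B x /\ ~ (exists2 y, B y & R y x)].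

Definition core (N X : Type) (W : set (set N)) (B : set X)
    (p : N -> X -> X -> Prop) : set X :=
  [set x | B x /\
    ~ (exists y S, [/\ B y, W S & forall i, S i -> p i y x])].

(* The core without majority dissatisfaction: the alternative [y] preferred
   to [x] may depend on the member [i] of the coalition. *)
Definition core_plus (N X : Type) (W : set (set N)) (B : set X)
    (p : N -> X -> X -> Prop) : set X :=
  [set x | B x /\
    ~ (exists2 S, W S & forall i, S i -> exists2 y, B y & p i y x)].

(* Main.v *)
Require Import Defs.
From mathcomp Require Import all_boot.
From mathcomp Require Import boolp classical_sets functions cardinality.
From mathcomp Require Import measurable_structure.

Local Open Scope classical_set_scope.

Theorem lemma6 (N X : Type) (BB W : set (set N)) (B : set X)
  (N_nonempty : [set: N] !=set0)
  (BB_algebra : algebra_of_sets BB)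
  (X_ge2 : (`I_2 #<= [set: X])%card)
  (W_game : simple_game BB W)
  (p : N -> X -> X -> Prop)
  (p_profile : profile p) :
  core_plus W B p `<=` core W B p `&` \bigcup_(i in [set: N]) max_on B (p i).
Proof.
move=> x [Bx x_core]; split.
  (* Domination by one [y] is the case of [core_plus] dissatisfaction in which all members of [S]
     choose the same alternative. *)
  split=> // -[y [S [By WS Syx]]]; apply: x_core.
  by exists S => // i Si; exists y => //; exact: Syx.
(* Any winning coalition will do: were [x] maximal for nobody, every individual, hence every member
   of [S], would prefer some alternative in [B] to [x], which [x_core] forbids. *)
have [_ _ [S WS]] := W_game.
apply: contrapT => x_not_max; apply: x_core; exists S => // i _.
by apply: contrapT => x_max_i; apply: x_not_max; exists i.
Qed.
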